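(* Let $d\ge2$ be an integer and let $\zeta\in\mathbb{C}$ be a primitive root of unity of order $d$. Then for any $q\ge1$, $r\in\{0,1,\ldots,d-1\}$, and $$n=2^{qd+r}+2^{(q-1)d+r}+\cdots+2^{d+r}+2^r=2^r\,\frac{2^{(q+1)d}-1}{2^d-1},$$ we have $$\mathcal{H}(n,2\zeta)\ne0.$$
   Context: For an integer $n\ge0$ with binary expansion $n=\sum_{j=0}^l\varepsilon_j2^j$, $\varepsilon_j\in\{0,1\}$, put $S(n,t)=\sum_{j=0}^l\varepsilon_jt^j$. For $n\ge1$ let $\mathcal{H}(n,t)=\det[S(i+j,t)]_{0\le i,j<n}$, a polynomial in $t$. *)

(* Defs.v *)
From mathcomp Require Import all_boot all_order all_algebra.
From mathcomp Require Import reals.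
From mathcomp Require Import complex.

Set Implicit Arguments.
Unset Strict Implicit.
Unset Printing Implicit Defensive.

Import GRing.Theory.
Local Open Scope ring_scope.

Definition bindigit (n j : nat) : nat := (n %/ 2 ^ j) %% 2.

(* For n > 0 the top binary digit has index l = trunc_log 2 n; for n = 0 this
   bound is 0 and the only digit is 0. *)
Definition S_poly (n : nat) : {poly int} :=
  \poly_(j < (trunc_log 2 n).+1) (bindigit n j)%:R.

Definition hankelS (n : nat) : {poly int} :=
  \det (\matrix_(i < n, j < n) S_poly (i + j)).

(* For d > 0 the sum is 2^r (2^((q+1)d) - 1) / (2^d - 1); multiplied out to
   avoid truncated division. *)
Lemma sum_pow2_closed (d q r : nat) :
  ((\sum_(k < q.+1) 2 ^ (k * d + r)) * (2 ^ d - 1)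
     = 2 ^ r * (2 ^ (q.+1 * d) - 1))%N.
Proof.
elim: q => [|q IHq]; first by rewrite big_ord1 mul0n add0n mul1n.
rewrite big_ord_recr /= mulnDl IHq expnD [(2 ^ _ * 2 ^ r)%N]mulnC -mulnA -mulnDr.
congr (_ * _)%N; rewrite mulnBr muln1 -expnD addnC -[(q.+1 * d + d)%N]mulSnr.
by rewrite addnBA ?expn_gt0 // subnK // leq_exp2l // mulSn leq_addl.
Qed.

Lemma S_poly0 : S_poly 0 = 0.
Proof. by apply/polyP=> i; rewrite coef_poly coef0 /bindigit div0n mod0n; case: ifP. Qed.

Lemma S_poly_coef (n j : nat) : (S_poly n)`_j = (bindigit n j)%:R.
Proof.
rewrite coef_poly; case: ltnP => // lt_j; rewrite /bindigit divn_small //.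
by apply: leq_trans (trunc_log_ltn n (isT : 1 < 2)%N) _; rewrite leq_exp2l.
Qed.

(* Main.v *)
Require Import Defs.
From mathcomp Require Import all_boot all_order all_algebra.
From mathcomp Require Import reals.
From mathcomp Require Import complex.
From mathcomp Require Import zify ring.
Local Open Scope ring_scope.

Import GRing.Theory.

(** The idea is to exhibit one Pade approximant of the generating series
    F(X) = sum_n S(n,t) X^n whose reduced denominator is so small that the next
    index of a nonzero Hankel determinant is forced to be n.

    Put y = X^(2^M). Since S(m + 2^M) = S(m) + t^M for m < 2^M, the product
    (1 - X)(1 - y) F agrees with a polynomial W (numer) of degree at most 2^M
    up to an error in degrees at least 2^(M+1), whose coefficient in that degree
    is t^M (t - 2) (denom_mul_trunc), which is nonzero for t = 2 zeta because
    zeta differs from 0 and 1. Moreover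
      1 - y = (1 - X) * prod_{j<M} (1 + X^(2^j)),
    and modulo 1 + X^(2^j) the numerator W is the constant
    t^M - 2^(M-j) t^j (numer_mod_fermat). For t = 2 zeta this constant is
    2^M (zeta^M - zeta^j), so that it vanishes exactly when j = M modulo d.
    Hence the fraction W / ((1 - X)(1 - y)) simplifies by exactly the product
    of the factors 1 + X^(2^j) with j < M and j = M modulo d, whose degree is
    s = sum of the corresponding 2^j. What remains is a reduced fraction p / Q
    with deg Q = 2^M + 1 - s and F - p / Q of order exactly 2^(M+1).

    The order of the error is deg Q + n - 1 for n = 2^M + s, and deg Q <= n as
    soon as s > 0. A kernel vector of the n by n Hankel matrix would give a
    second approximant with denominator of degree < n; it would have to be
    C p / C Q for a polynomial C of degree < n - deg Q, which is incompatible
    with the exact order of the error (hankel_det_neq0). With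
    M = q d + r the number 2^M + s is the n of the theorem, and q >= 1 is what
    makes s positive. *)

(** * Hankel determinants and Pade approximants *)

(** In terms of the series s in X, a Hankel kernel vector is the list of
    coefficients of a polynomial B of degree < N such that B * s has no
    coefficients in degrees N - 1 to 2N - 2. Comparing with the approximant
    p / q by cross multiplication gives B = C * q, and the remaining error
    C * u must then be divisible by 'X^(N - L) although C has too small
    a degree for that. *)
Lemma hankel_det_neq0 (F : fieldType) (s : nat -> F) (N L : nat)
    (p q u : {poly F}) :
    (L <= N)%N -> size q = L.+1 -> (size p <= L)%N -> coprimep q p ->
    u`_0 != 0 ->
    q * \poly_(i < N.*2) s i = p + 'X^((N + L).-1) * u ->
  \det (\matrix_(i < N, j < N) s (i + j)%N) != 0.
Proof.
move=> leLN szq szp cqp u0 approx; apply/negP => /det0P[b b_neq0 bH0].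
have N_gt0 : (0 < N)%N.
  by case: N b b_neq0 {leLN approx bH0} => // b; rewrite thinmx0 eqxx.
(* The coefficients are reversed because the Hankel matrix pairs b_j with
   s_(i + j), whereas a product of series pairs indices of constant sum. *)
pose B : {poly F} := \sum_(j < N) b 0 j *: 'X^(N.-1 - j).
have szB : (size B <= N)%N.
  apply: (leq_trans (size_sum _ _ _)); apply/bigmax_leqP => j _.
  by rewrite (leq_trans (size_scale_leq _ _)) // size_polyXn; lia.
have B_neq0 : B != 0.
  apply: contra_neq b_neq0 => B0; apply/rowP => j; rewrite mxE.
  have := congr1 (coefp (N.-1 - j)) B0.
  rewrite /= coef0 coef_sum (bigD1 j) //= coefZ coefXn eqxx mulr1 big1 ?addr0 //.
  move=> k kj; rewrite coefZ coefXn; case: eqP => [e|_]; last by rewrite mulr0.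
  by case/eqP: kj; apply: val_inj => /=; move: (ltn_ord k) (ltn_ord j); lia.
pose T := B * \poly_(i < N.*2) s i.
have T_gap i : (N.-1 <= i < N.*2.-1)%N -> T`_i = 0.
  move=> /andP[le1 le2]; have ltiN : (i - N.-1 < N)%N by lia.
  have := congr1 (fun v : 'rV_N => v 0 (Ordinal ltiN)) bH0.
  rewrite !mxE => bHi; rewrite -[RHS]bHi /T mulr_suml coef_sum.
  apply: eq_bigr => j _; have := ltn_ord j => ltjN.
  rewrite -scalerAl coefZ coefXnM ifF; last by lia.
  by rewrite coef_poly ifT ?mxE /=; [congr (_ * s _); lia | lia].
pose A := take_poly N.-1 T; pose v := drop_poly N.*2.-1 T.
have defT : T = A + 'X^(N.*2.-1) * v.
  apply/polyP => i; rewrite coefD coef_take_poly coefXnM coef_drop_poly.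
  case: ltnP => i1; first by rewrite ifT ?addr0 //; lia.
  by rewrite add0r; case: ltnP => i2; [apply: T_gap; lia | congr T`_(_); lia].
have szA : (size A <= N.-1)%N by exact: size_take_poly.
have splitX : 'X^(N.*2.-1) = 'X^((N + L).-1) * 'X^(N - L) :> {poly F}.
  by rewrite -exprD; congr ('X^_); lia.
(* Both sides of cross multiplication: the left one has size < N + L, the right
   one has valuation at least N + L - 1, and hence both vanish. *)
have key : B * p - q * A = 'X^((N + L).-1) * (q * 'X^(N - L) * v - B * u).
  have : B * (p + 'X^((N + L).-1) * u) = q * (A + 'X^(N.*2.-1) * v).
    by rewrite -approx -defT /T; ring.
  rewrite splitX => e.
  have -> : B * p = q * (A + 'X^((N + L).-1) * 'X^(N - L) * v)
                    - B * 'X^((N + L).-1) * u by rewrite -e; ring.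
  by ring.
have low : (size (B * p - q * A)%R < (N + L))%N.
  rewrite (leq_ltn_trans (size_polyD _ _)) // gtn_max size_polyN.
  apply/andP; split; apply: leq_ltn_trans (size_polyMleq _ _) _.
    by move: szB szp; move: (size B) (size p) => a c; lia.
  by rewrite szq; move: szA; move: (size A) => a; lia.
have high0 : q * 'X^(N - L) * v - B * u = 0.
  apply/eqP; apply: contraTT low => h_neq0; rewrite key mulrC size_mulXn //.
  by rewrite -leqNgt; move: h_neq0; rewrite -size_poly_gt0; lia.
have BpqA : B * p = q * A.
  by apply/eqP; rewrite -subr_eq0 key high0 mulr0.
have [C defB] : exists C, B = C * q.
  by apply/dvdpP; rewrite -(Gauss_dvdpl _ cqp) BpqA dvdp_mulr.
have q_neq0 : q != 0 by rewrite -size_poly_gt0 szq.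
have CuX : C * u = 'X^(N - L) * v.
  apply: (mulfI q_neq0); apply/eqP; rewrite -subr_eq0 -oppr_eq0 -high0 defB.
  by apply/eqP; ring.
(* C has size at most N - L, so being divisible by 'X^(N - L) kills it. *)
have X_dvd_C : 'X^(N - L) %| C.
  rewrite -(@Gauss_dvdpl _ C u) ?CuX ?dvdp_mulr //.
  by rewrite coprimep_expl // coprimep_sym coprimepX rootE horner_coef0.
have C_neq0 : C != 0 by apply: contraNneq B_neq0 => C0; rewrite defB C0 mul0r.
have := dvdp_leq C_neq0 X_dvd_C; rewrite size_polyXn.
by move: szB; rewrite defB size_mul // szq; lia.
Qed.

(** * The generating series of the digit polynomials *)

Section DigitSums.

Variables (F : fieldType) (t : F).

Definition digit_eval n : F := (map_poly intr (S_poly n)).[t].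

Lemma digit_eval0 : digit_eval 0 = 0.
Proof. by rewrite /digit_eval S_poly0 rmorph0 horner0. Qed.

Lemma S_poly_add_pow2 M n : (n < 2 ^ M)%N ->
  S_poly (n + 2 ^ M) = S_poly n + 'X^M.
Proof.
move=> ltnM; apply/polyP => j; rewrite coefD coefXn !S_poly_coef /bindigit.
have [ltjM | ltMj | ->] := ltngtP j M.
- rewrite addr0 -(subnK ltjM) addnS -addSn expnD addnC divnMDl ?expn_gt0 //.
  by rewrite expnS -modnDml mulnC modnMl add0n.
- have : (2 ^ M.+1 <= 2 ^ j)%N by rewrite leq_exp2l.
  by rewrite expnS => le2; rewrite addr0 !divn_small //; lia.
- by rewrite divnDr // divnn expn_gt0 /= divn_small.
Qed.

Lemma digit_eval_add_pow2 M n : (n < 2 ^ M)%N ->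
  digit_eval (n + 2 ^ M) = digit_eval n + t ^+ M.
Proof.
move=> ltnM; rewrite /digit_eval S_poly_add_pow2 // rmorphD /=.
by rewrite map_polyXn !hornerE.
Qed.

(** The factor 1 - 'X turns the sum of the powers 'X^i over i < 2 ^ M into
    1 - 'X^(2 ^ M), which keeps the recurrence blockS short. *)
Definition block M : {poly F} := (1 - 'X) * \poly_(i < 2 ^ M) digit_eval i.

(** The second half of a block of length 2 ^ M.+1 repeats the first half, with
    t ^+ M added to each term. *)
Lemma blockS M :
  block M.+1 = (1 + 'X^(2 ^ M)) * block M
               + t ^+ M *: ('X^(2 ^ M) * (1 - 'X^(2 ^ M))).
Proof.
have geom : 1 - 'X^(2 ^ M) = (1 - 'X) * \poly_(i < 2 ^ M) 1 :> {poly F}.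
  rewrite -[LHS]opprB subrX1 -mulNr opprB poly_def.
  by congr (_ * _); apply: eq_bigr => i _; rewrite scale1r.
rewrite /block.
have -> : \poly_(i < 2 ^ M.+1) digit_eval i
   = (1 + 'X^(2 ^ M)) * \poly_(i < 2 ^ M) digit_eval i
     + t ^+ M *: ('X^(2 ^ M) * \poly_(i < 2 ^ M) 1) :> {poly F}.
  apply/polyP => i; rewrite coefD coefZ mulrDl mul1r coefD !coefXnM !coef_poly.
  rewrite expnS mul2n -addnn.
  have [lt1|le1] := ltnP i (2 ^ M).
    by rewrite ifT; [rewrite mulr0 !addr0 | lia].
  rewrite add0r ltn_subLR //; case: ltnP => lti; last by rewrite mulr0 addr0.
  by rewrite mulr1 -digit_eval_add_pow2 ?subnK //; lia.
by rewrite geom -!mul_polyC; ring.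
Qed.

Lemma one_minus_Xpow2 M :
  1 - 'X^(2 ^ M) = (1 - 'X) * \prod_(j < M) (1 + 'X^(2 ^ j)) :> {poly F}.
Proof.
elim: M => [|M IHM]; first by rewrite big_ord0 mulr1.
by rewrite big_ord_recr mulrA -IHM /= expnS mul2n -addnn exprD; ring.
Qed.

Lemma fermat_dvd (j M : nat) : (j < M)%N ->
  (1 + 'X^(2 ^ j) : {poly F}) %| 1 - 'X^(2 ^ M).
Proof.
move=> ltjM; rewrite one_minus_Xpow2 (bigD1 (Ordinal ltjM)) //=.
by rewrite dvdp_mull // dvdp_mulr.
Qed.

(** The numerator of the approximant with denominator
    (1 - 'X) * (1 - 'X^(2 ^ M)), see denom_mul_trunc. *)
Definition numer M : {poly F} := block M + t ^+ M *: 'X^(2 ^ M).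

(** Modulo 1 + 'X^(2 ^ j) the variable satisfies 'X^(2 ^ j) = -1, hence
    'X^(2 ^ i) = 1 for i > j: in the recurrence blockS step j replaces the
    block by -2 t^j, and each later step doubles it. *)
Lemma block_mod_fermat (j M : nat) : (j < M)%N ->
  1 + 'X^(2 ^ j) %| block M + (2 ^+ (M - j) * t ^+ j)%:P.
Proof.
elim: M => // M IHM; rewrite ltnS leq_eqVlt => /predU1P[->|ltjM].
  rewrite blockS subSn // subnn expr1 -mul_polyC.
  have -> : (2 * t ^+ M)%:P = (t ^+ M)%:P *+ 2 :> {poly F}.
    by rewrite -[2]/(1 *+ 2) mulrnAl mul1r polyCMn.
  set c := (t ^+ M)%:P; set y := 'X^ _.
  have -> : (1 + y) * block M + c * (y * (1 - y)) + c *+ 2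
          = (1 + y) * (block M + c * (2 - y)) by ring.
  exact: dvdp_mulr.
have -> : block M.+1 + (2 ^+ (M.+1 - j) * t ^+ j)%:P
    = 2%:R * (block M + (2 ^+ (M - j) * t ^+ j)%:P)
      + (1 - 'X^(2 ^ M)) * (t ^+ M *: 'X^(2 ^ M) - block M).
  rewrite blockS subSn ?exprS; last exact: ltnW.
  by rewrite -[2 in LHS]/(1 *+ 2) -mulrA mulrnAl mul1r polyCMn -!mul_polyC; ring.
apply: dvdp_add; first by apply: dvdp_mull; exact: IHM.
by apply: dvdp_mulr; exact: fermat_dvd.
Qed.

(** The constant here decides whether the factor 1 + 'X^(2 ^ j) of the
    denominator cancels: it is proportional to the residue of the approximant
    at each root of 1 + 'X^(2 ^ j). *)
Lemma numer_mod_fermat (j M : nat) : (j < M)%N ->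
  1 + 'X^(2 ^ j) %| numer M - (t ^+ M - 2 ^+ (M - j) * t ^+ j)%:P.
Proof.
move=> ltjM.
have -> : numer M - (t ^+ M - 2 ^+ (M - j) * t ^+ j)%:P
    = block M + (2 ^+ (M - j) * t ^+ j)%:P - (t ^+ M)%:P * (1 - 'X^(2 ^ M)).
  by rewrite /numer polyCB -mul_polyC; ring.
apply: dvdp_sub; first exact: block_mod_fermat.
by apply: dvdp_mull; exact: fermat_dvd.
Qed.

Lemma numer_coprime_1subX M : t != 0 -> coprimep (numer M) (1 - 'X).
Proof.
move=> t0; rewrite -opprB -scaleN1r coprimepZr ?oppr_eq0 ?oner_eq0 //.
rewrite -polyC1 coprimep_XsubC rootE /numer /block.
by rewrite !hornerE subrr mul0r add0r expr1n mulr1 expf_neq0.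
Qed.

Lemma size_numer M : (size (numer M) <= (2 ^ M).+1)%N.
Proof.
rewrite (leq_trans (size_polyD _ _)) // geq_max; apply/andP; split; last first.
  by rewrite (leq_trans (size_scale_leq _ _)) // size_polyXn.
apply: leq_trans (size_polyMleq _ _) _.
rewrite -opprB size_polyN size_XsubC; exact: size_poly.
Qed.

(** The error starts as late as degree 2 ^ M.+1 because
    digit_eval (m + 2 ^ M) - digit_eval m is the same constant t ^+ M for all
    m < 2 ^ M. At m = 2 ^ M the difference becomes t ^+ M.+1 - t ^+ M, which
    yields the leading coefficient of the error. *)
Lemma denom_mul_trunc (M K : nat) : (2 ^ M.+1 < K)%N ->
  exists u : {poly F},
    [/\ u`_0 = t ^+ M * (t - 2)
      & (1 - 'X) * (1 - 'X^(2 ^ M)) * \poly_(i < K) digit_eval i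
        = numer M + 'X^(2 ^ M.+1) * u].
Proof.
move=> ltMK; set G := \poly_(i < K) _.
have G0 : (drop_poly (2 ^ M.+1) G)`_0 = t ^+ M.+1.
  rewrite coef_drop_poly add0n coef_poly ltMK -[(2 ^ M.+1)%N]add0n.
  by rewrite digit_eval_add_pow2 ?expn_gt0 // digit_eval0 add0r.
have defG : G = \poly_(i < 2 ^ M.+1) digit_eval i
                + 'X^(2 ^ M.+1) * drop_poly (2 ^ M.+1) G.
  rewrite -[LHS](poly_take_drop (2 ^ M.+1)) [drop_poly _ _ * _]mulrC.
  congr (_ + _).
  apply/polyP => i; rewrite coef_take_poly !coef_poly; case: ifP => // lti.
  by rewrite (ltn_trans lti).
exists (- numer M + (t ^+ M)%:P * ('X^(2 ^ M) *+ 2 - 2%:R)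
        + (1 - 'X) * (1 - 'X^(2 ^ M)) * drop_poly (2 ^ M.+1) G); split.
  have y0 : (0 ^+ (2 ^ M) : F) = 0 by rewrite expr0n expn_eq0.
  rewrite -horner_coef0 /numer /block !(hornerE, y0) !horner_coef0 G0.
  rewrite coef_poly digit_eval0 if_same mulr0 oppr0 add0r.
  by rewrite addr0 !mul1r exprSr mulrBr mulrN addrC.
rewrite [in LHS]defG mulrDr mulrAC -/(block M.+1) blockS /numer -!mul_polyC.
by rewrite expnS mul2n -addnn exprD; ring.
Qed.

End DigitSums.

(** * Cancellation of the factors 1 + 'X^(2 ^ j) *)

Lemma coprimep_polyC (F : fieldType) (p : {poly F}) (c : F) :
  c != 0 -> coprimep p c%:P.
Proof. by move=> c0; rewrite -[c%:P]mulr1 mul_polyC coprimepZr // coprimep1. Qed.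

Lemma size_prod_fermat (F : fieldType) (M : nat) (P : pred 'I_M) :
  size (\prod_(j < M | P j) (1 + 'X^(2 ^ j) : {poly F}))
    = (\sum_(j < M | P j) 2 ^ j).+1%N.
Proof.
elim/big_rec2: _ => [|j n g _ szg]; first by rewrite size_poly1.
have szj : size (1 + 'X^(2 ^ j) : {poly F}) = (2 ^ j).+1.
  by rewrite addrC -polyC1 size_XnaddC ?expn_gt0.
have g0 : g != 0 by rewrite -size_poly_gt0 szg.
by rewrite size_mul -?size_poly_gt0 ?szg ?szj // addSn addnS.
Qed.

(** In odd characteristic or characteristic 0 the factors 1 + 'X^(2 ^ j) are
    pairwise coprime, like the Fermat numbers: the earlier ones divide
    1 - 'X^(2 ^ M), which is 2 modulo 1 + 'X^(2 ^ M). *)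
Lemma prod_fermat_dvd (F : fieldType) (P : pred nat) (w : {poly F}) (M : nat) :
    (2 : F) != 0 ->
    (forall j, (j < M)%N -> P j -> 1 + 'X^(2 ^ j) %| w) ->
  \prod_(j < M | P j) (1 + 'X^(2 ^ j) : {poly F}) %| w.
Proof.
move=> two0; elim: M => [|M IHM] dvdw; first by rewrite big_ord0 dvd1p.
have IH : \prod_(j < M | P j) (1 + 'X^(2 ^ j) : {poly F}) %| w.
  by apply: IHM => j ltjM; apply: dvdw; exact: ltnW.
rewrite big_mkcond big_ord_recr -big_mkcond /=.
case: ifP => PM; last by rewrite mulr1.
rewrite Gauss_dvdp ?IH ?dvdw //.
have cop : coprimep (1 - 'X^(2 ^ M) : {poly F}) (1 + 'X^(2 ^ M)).
  have -> : 1 - 'X^(2 ^ M) = -1 * (1 + 'X^(2 ^ M)) + 2%:P :> {poly F}.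
    by rewrite -[2]/(1 *+ 2) polyCMn; ring.
  by rewrite coprimep_sym coprimep_addl_mul coprimep_polyC.
apply: coprimep_dvdr cop; rewrite one_minus_Xpow2.
rewrite [X in _ %| _ * X](bigID (fun j : 'I_M => P j)) /=.
by rewrite dvdp_mull // dvdp_mulr.
Qed.

(** The sum s is the total degree of the factors that cancel in the approximant
    numer M / ((1 - 'X) * (1 - 'X^(2 ^ M))), so that the reduced denominator has
    degree 2 ^ M + 1 - s. A positive s makes this degree small enough for
    hankel_det_neq0. *)
Lemma hankel_digit_eval_neq0 (F : fieldType) (t : F) (M s : nat) :
    (2 : F) != 0 -> t != 0 -> t != 2 ->
    s = (\sum_(j < M | (t ^+ M == 2 ^+ (M - j) * t ^+ j)%R) 2 ^ j)%N ->
    (0 < s)%N ->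
  \det (\matrix_(i < 2 ^ M + s, j < 2 ^ M + s) digit_eval F t (i + j)) != 0.
Proof.
move=> two0 t0 t2 def_s s_gt0; set n := (2 ^ M + s)%N.
pose P (j : nat) := t ^+ M == 2 ^+ (M - j) * t ^+ j.
pose g : {poly F} := \prod_(j < M | P j) (1 + 'X^(2 ^ j)).
pose Q : {poly F} := (1 - 'X) ^+ 2 * \prod_(j < M | ~~ P j) (1 + 'X^(2 ^ j)).
have szg : size g = s.+1 by rewrite def_s; exact: size_prod_fermat.
have g0 : g != 0 by rewrite -size_poly_gt0 szg.
have defD : (1 - 'X) * (1 - 'X^(2 ^ M)) = g * Q.
  rewrite one_minus_Xpow2 (bigID (fun j : 'I_M => P j)) /= -/g /Q.
  by rewrite expr2; ring.
have szD : size ((1 - 'X) * (1 - 'X^(2 ^ M)) : {poly F}) = (2 ^ M).+2.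
  rewrite -mulrNN !opprB -polyC1 size_mul -?size_poly_gt0.
  - by rewrite size_XsubC size_XnsubC ?expn_gt0.
  - by rewrite size_XsubC.
  - by rewrite size_XnsubC ?expn_gt0.
have Q0 : Q != 0.
  by apply: contra_eqN szD => /eqP Q0; rewrite defD Q0 mulr0 size_poly0.
have szQ : (s + size Q = (2 ^ M).+2)%N.
  by have := szD; rewrite defD size_mul // szg addSn.
have g_dvd : g %| numer F t M.
  apply: prod_fermat_dvd => // j ltjM /eqP Pj.
  by have := numer_mod_fermat F t j M ltjM; rewrite -Pj subrr subr0.
have Q_cop : coprimep Q (numer F t M).
  rewrite coprimep_sym coprimepMr coprimep_expr ?numer_coprime_1subX //=.
  apply: (big_ind (fun v => coprimep (numer F t M) v)).
  - exact: coprimep1.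
  - by move=> v1 v2 c1 c2; rewrite coprimepMr c1 c2.
  move=> j nPj; have /dvdpP[h eh] := numer_mod_fermat F t j M (ltn_ord j).
  rewrite -[numer F t M](subrK (t ^+ M - 2 ^+ (M - j) * t ^+ j)%:P) eh.
  by rewrite coprimep_sym coprimep_addl_mul coprimep_polyC // subr_eq0.
have /dvdpP[p defW] := g_dvd.
have p0 : p != 0.
  apply: contraTneq (numer_coprime_1subX F t M t0) => p0.
  rewrite defW p0 mul0r coprime0p -size_poly_eq1 -opprB size_polyN -polyC1.
  by rewrite size_XsubC.
have szp : (s + size p <= (2 ^ M).+1)%N.
  by have := size_numer F t M; rewrite defW size_mul // szg addnS addnC.
have lt_2M_2n : (2 ^ M.+1 < n.*2)%N by rewrite expnS /n; lia.
have [u [u0 approx]] := denom_mul_trunc F t M _ lt_2M_2n.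
pose G := \poly_(i < n.*2) digit_eval F t i.
have cop_Xg : coprimep 'X^(2 ^ M.+1) g.
  rewrite coprimep_expl // coprimep_sym coprimepX; apply/negP => /rootP g00.
  have := congr1 (horner^~ 0) defD.
  rewrite !hornerE g00 expr0n expn_eq0 /= mul0r => /eqP.
  by rewrite !(subr0, addr0, mulr1) mul0r oner_eq0.
(* As g divides both denominator and numerator and is prime to X, it cancels
   from the congruence without changing the order of the remainder. *)
have gv : g * (Q * G - p) = 'X^(2 ^ M.+1) * u.
  by rewrite mulrBr mulrA -defD approx defW; ring.
have [v defv] : exists v, Q * G - p = 'X^(2 ^ M.+1) * v.
  have /dvdpP[v ->] : 'X^(2 ^ M.+1) %| Q * G - p.
    by rewrite -(Gauss_dvdpr _ cop_Xg) gv dvdp_mulr.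
  by exists v; rewrite mulrC.
have v0 : v`_0 != 0.
  have gvu : g * v = u.
    apply: (mulfI (_ : 'X^(2 ^ M.+1) != 0)); first by rewrite monic_neq0 ?monicXn.
    by rewrite -gv defv; ring.
  have : u`_0 != 0 by rewrite u0 mulf_neq0 ?expf_neq0 // subr_eq0.
  by rewrite -gvu coef0M mulf_eq0 negb_or => /andP[].
(* deg Q = 2 ^ M + 1 - s, so n + deg Q - 1 is exactly the order 2 ^ M.+1; the
   inequality deg Q <= n is where s > 0 enters. *)
have eqe : (n + (size Q).-1).-1 = (2 ^ M.+1)%N by rewrite expnS /n; lia.
apply: (hankel_det_neq0 F _ n (size Q).-1 p Q v) => //.
- by rewrite /n; lia.
- by rewrite prednK // size_poly_gt0.
- by lia.
- by apply: coprimep_dvdl Q_cop; rewrite defW dvdp_mulr.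
- by rewrite eqe -defv addrC subrK.
Qed.

(** * The values at twice a root of unity *)

Lemma sum_arith_prog (f : nat -> nat) (d q r : nat) : (r < d)%N ->
  (\sum_(j < q * d + r | j == q * d + r %[mod d]) f j
     = \sum_(k < q) f (k * d + r))%N.
Proof.
move=> ltrd; have d_gt0 : (0 < d)%N by lia.
transitivity (\sum_(0 <= j < q * d + r | j %% d == r) f j)%N.
  by rewrite big_mkord; apply: eq_bigl => j; rewrite modnMDl (modn_small ltrd).
elim: q => [|q IHq].
  rewrite big_ord0 big_nat_cond big1 // => j; rewrite mul0n add0n => /andP[ltjr].
  by rewrite modn_small; lia.
rewrite big_ord_recr /= -IHq (@big_cat_nat _ _ _ (q * d + r)) /=; [|lia|lia].
congr addn; rewrite big_ltn_cond; last by lia.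
rewrite modnMDl modn_small // eqxx big_nat_cond big1 ?addn0 // => j.
case/andP=> /andP[le1 le2] /eqP jr; have := divn_eq j d; rewrite jr.
move: (j %/ d)%N => e ej.
have : (q < e)%N by rewrite -(ltn_pmul2r d_gt0); lia.
by rewrite -(leq_pmul2r d_gt0); lia.
Qed.

(** For t = 2 zeta the two sides of the cancellation condition are
    2 ^+ M * zeta ^+ M and 2 ^+ M * zeta ^+ j, so the condition becomes
    a congruence modulo d. *)
Lemma hankelS_2zeta_neq0 (F : fieldType) (two0 : (2 : F) != 0) (d : nat)
    (hd : (2 <= d)%N) (zeta : F) (hzeta : d.-primitive_root zeta)
    (q : nat) (hq : (1 <= q)%N) (r : nat) (hr : (r < d)%N) :
  (map_poly intr (hankelS (\sum_(k < q.+1) 2 ^ (k * d + r)))).[2 * zeta] != 0.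
Proof.
set t := 2 * zeta; set M := (q * d + r)%N; set n := (\sum_(k < _) _)%N.
have zeta0 : zeta != 0.
  apply/eqP => z0; have := prim_expr_order hzeta; rewrite z0 expr0n.
  by case: (d) hd => // ? _ /eqP; rewrite eq_sym oner_eq0.
have zeta1 : zeta != 1.
  have := eq_prim_root_expr hzeta 1 0; rewrite expr1 expr0 => ->.
  by rewrite mod0n modn_small.
have -> : (map_poly intr (hankelS n)).[t]
    = \det (\matrix_(i < n, j < n) digit_eval F t (i + j)).
  rewrite /hankelS -det_map_mx -[LHS]/(horner_eval t _) -det_map_mx.
  by congr (\det _); apply/matrixP => i j; rewrite !mxE.
have residueE (j : 'I_M) :
    (t ^+ M == 2 ^+ (M - j) * t ^+ j) = (j == M %[mod d]).
  rewrite /t !exprMn mulrA -exprD subnK; last exact: ltnW.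
  by rewrite (inj_eq (mulfI _)) ?expf_neq0 // eq_sym (eq_prim_root_expr hzeta).
have -> : n = (2 ^ M + \sum_(k < q) 2 ^ (k * d + r))%N.
  by rewrite /n big_ord_recr; exact: addnC.
apply: hankel_digit_eval_neq0 => //.
- by rewrite mulf_neq0.
- by rewrite -[X in _ != X]mulr1 (inj_eq (mulfI two0)).
- by rewrite (eq_bigl _ _ residueE) (sum_arith_prog (expn 2) _ _ _ hr).
- by case: (q) hq => // q' _; rewrite big_ord_recl addn_gt0 expn_gt0.
Qed.

Theorem theorem5p10 (R : realType) (d : nat) (hd : (2 <= d)%N)
    (zeta : R[i]) (hzeta : d.-primitive_root zeta)
    (q : nat) (hq : (1 <= q)%N) (r : nat) (hr : (r < d)%N)
    (n : nat) (hn : n = (\sum_(k < q.+1) 2 ^ (k * d + r))%N) :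
  (map_poly intr (hankelS n)).[2 * zeta] != 0.
Proof.
rewrite hn; apply: hankelS_2zeta_neq0 => //.
by rewrite Num.Theory.pnatr_eq0.
Qed.
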